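(* Let $X$ be a completely regular space. Let $H$ be a non-vanishing closed ideal in $C_B(X)$. The following are equivalent: (1) $\mathfrak{sp}(H)$ is pseudocompact. (2) $H$ has no subideal of the form $\bigoplus_{i\in I}H_i$ where $\{H_i:i\in I\}$ is an infinite (faithfully indexed) collection of closed subideals of $H$ such that for every maximal closed subideal $M$ of $H$ there is an $f$ in $H\setminus M$ such that $\langle f\rangle\cap H_i=0$ except for at most one $i$ in $I$.
   Context: Completely regular spaces are assumed Hausdorff. The scalar field $\mathbb{F}$ is fixed and is $\mathbb{R}$ or $\mathbb{C}$. $C_B(X)$ is the Banach algebra of all bounded continuous mappings $X\to\mathbb{F}$ with pointwise addition and multiplication and the supremum norm. $\beta X$ is the Stone–Čech compactification of $X$ (containing $X$ as a dense subspace), and for $f\in C_B(X)$, $f_\beta:\beta X\to\mathbb{F}$ is its unique continuous extension. For $f:Y\to\mathbb{F}$, $\mathrm{coz}(f)=\{y\in Y:f(y)\neq0\}$. An ideal $H$ of $C_B(X)$ is non-vanishing if for every $x\in X$ there is $h\in H$ with $h(x)\neq0$. For a non-vanishing closed ideal $H$ of $C_B(X)$, its spectrum is the subspace $\mathfrak{sp}(H)=\bigcup_{h\in H}\mathrm{coz}(h_\beta)$ of $\beta X$. A (closed) subideal of $H$ is a (closed) ideal of $C_B(X)$ contained in $H$; a maximal closed subideal of $H$ is a closed subideal that is maximal under inclusion among the closed subideals of $H$ different from $H$. $\langle f\rangle$ is the ideal of $C_B(X)$ generated by $f$. $\bigoplus_{i\in I}H_i$ denotes the internal algebraic direct sum: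 the sum $\sum_{i\in I}H_i$ (all finite sums of elements of the $H_i$), under the requirement that $H_{i_0}\cap\sum_{i_0\neq i\in I}H_i=0$ for every $i_0\in I$. Faithfully indexed means $H_i\neq H_j$ for $i\neq j$. A completely regular space is pseudocompact if every continuous scalar-valued mapping on it is bounded. *)

(* Defs.v *)
From HB Require Import structures.
From mathcomp Require Import all_boot all_order all_algebra.
From mathcomp Require Import all_classical all_reals all_analysis.
From mathcomp Require Import complex.

Set Implicit Arguments.
Unset Strict Implicit.
Unset Printing Implicit Defensive.

Import Order.TTheory GRing.Theory Num.Theory.
Import numFieldNormedType.Exports.

Local Open Scope classical_set_scope.
Local Open Scope ring_scope.

Variant scalar_kind := RealScalars | ComplexScalars.

Definition scalars (R : realType) (k : scalar_kind) : numFieldType :=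
  match k with
  | RealScalars => R
  | ComplexScalars => complex R
  end.

Section BoundedContinuous.
Context {F : numFieldType} {X : topologicalType}.

Definition CB : set (X -> F) :=
  [set f | continuous f /\ [bounded f x | x in [set: X]]].

Definition coz {Y : Type} (f : Y -> F) : set Y := [set y | f y != 0].

(* Ideals of [CB] are sets of functions on [X]; stability under scalars is
   stability under multiplication by constant functions. *)
Definition ideal (A : set (X -> F)) : Prop :=
  [/\ A `<=` CB,
      A 0,
      (forall f g, A f -> A g -> A (f + g)) &
      (forall a f, CB a -> A f -> A (a * f))].

(* Closedness in [CB] for the supremum norm: the supremum-norm topology is the
   one induced on [CB] by the topology of uniform convergence on [X -> F]. *)
Definition closed_ideal (A : set (X -> F)) : Prop :=
  ideal A /\ closure (A : set {uniform X -> F}) `&` CB `<=` A.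

Definition non_vanishing (A : set (X -> F)) : Prop :=
  forall x : X, exists2 h, A h & h x != 0.

Definition subideal (H A : set (X -> F)) : Prop := ideal A /\ A `<=` H.

Definition closed_subideal (H A : set (X -> F)) : Prop :=
  closed_ideal A /\ A `<=` H.

Definition maximal_closed_subideal (H M : set (X -> F)) : Prop :=
  [/\ closed_subideal H M, M <> H &
      forall N, closed_subideal H N -> N <> H -> M `<=` N -> N = M].

Definition ideal_gen (f : X -> F) : set (X -> F) := smallest ideal [set f].

Definition ideal_sum {I : Type} (J : set I) (A : I -> set (X -> F)) :
    set (X -> F) :=
  [set f | exists (n : nat) (g : 'I_n -> X -> F),
     (forall l, exists2 i, J i & A i (g l)) /\ f = \sum_(l < n) g l].

Definition is_direct_sum {I : Type} (A : I -> set (X -> F))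
    (D : set (X -> F)) : Prop :=
  (forall i0, A i0 `&` ideal_sum [set i | i0 <> i] A = [set 0]) /\
  D = ideal_sum [set: I] A.

(* [iota : X -> bX] exhibits [bX] as the Stone-Cech compactification of [X]: the
   compactification of [X] over which every function in [CB] extends.  It is
   determined by this property up to a homeomorphism fixing [X]. *)
Definition is_stone_cech {bX : topologicalType} (iota : X -> bX) : Prop :=
  [/\ compact [set: bX] /\ hausdorff_space bX,
      injective iota,
      (forall U : set X,
         open U <-> exists2 V : set bX, open V & U = iota @^-1` V),
      dense (range iota) &
      forall f, CB f -> exists2 g : bX -> F, continuous g & g \o iota = f].

(* The continuous extension of [f] along [iota], unique when it exists since
   [range iota] is dense; the default value is irrelevant for [f] in [CB]. *)
Definition extension {bX : topologicalType} (iota : X -> bX) (f : X -> F) :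
    bX -> F :=
  xget 0 [set g : bX -> F | continuous g /\ g \o iota = f].

Definition spectrum {bX : topologicalType} (iota : X -> bX)
    (H : set (X -> F)) : set bX :=
  \bigcup_(h in H) coz (extension iota h).

End BoundedContinuous.

Arguments CB : clear implicits.
Arguments is_stone_cech F {X bX} iota.

(* Pseudocompactness of the subspace [A] of [Y]. *)
Definition pseudocompact (F : numFieldType) {Y : topologicalType}
    (A : set Y) : Prop :=
  forall f : Y -> F, {within A, continuous f} -> [bounded f y | y in A].

(* Main.v *)
Require Import Defs.
From HB Require Import structures.
From mathcomp Require Import all_boot all_order all_algebra.
From mathcomp Require Import all_classical all_reals all_analysis.
From mathcomp Require Import complex.

Set Implicit Arguments.
Unset Strict Implicit.
Unset Printing Implicit Defensive.

Import Order.TTheory GRing.Theory Num.Theory.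
Import numFieldNormedType.Exports.

Local Open Scope classical_set_scope.
Local Open Scope ring_scope.

(** Write S for the spectrum of H, an open subset of the Stone-Cech
    compactification bX, and ext h for the extension of h to bX.  The closed
    subideals of H behave like the open subsets of S, where an ideal A goes to
    the union of the sets where ext g does not vanish, g in A.  Under this
    dictionary the maximal closed subideals are the ideals of functions of H
    vanishing at one point of S, two ideals meet in 0 when their open sets are
    disjoint, and condition (2) says that S has no infinite family of nonempty
    open sets such that every point has a neighbourhood meeting at most one of
    them.  For a completely regular space that is pseudocompactness.

    Given such a family of ideals, every point y of S yields a maximal closed
    subideal (point_maximal), hence a neighbourhood of y meeting at most one of
    the open sets (discrete_family_locally).  Choose g_n in infinitely many
    different ideals with g_n taking the value n.  On S at most one ext g_n is
    nonzero near any point, so their sum is continuous there, and unbounded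
    (unbounded_of_discrete_family).

    Conversely let f be continuous and unbounded on S.  Its modulus v is already
    unbounded on the dense subset X, so there are points t_n of X with
    v (t_n) growing in steps of more than 4.  The functions of H supported in
    the shell where v is within 1 of v (t_n) form a closed ideal, and the
    shells are far apart for v.  A maximal closed subideal M vanishes at some
    y in S, because a closed subideal without common zero in S is all of H
    (closed_subideal_full); multiplying some h in H with ext h y nonzero by a
    bump function of v around the modulus of f y gives an element of H outside M
    which meets at most one shell (discrete_family_of_unbounded).

    The real and complex scalars are treated at once, over any numeric field;
    the first direction uses in addition that the field is archimedean.  All
    auxiliary scalar functions are therefore expressed through the norm. *)

(** * Scalar functions built from the norm *)

Section Scalars.
Context {F : numFieldType}.

(** Complex conjugation, in a form that makes sense in every numeric field; the
    value at 0 is 0 by the convention on inverses. *)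
Definition conjn (z : F) : F := `|z| ^+ 2 / z.

Lemma conjnM z : conjn z * z = `|z| ^+ 2.
Proof.
rewrite /conjn; have [->|z0] := eqVneq z 0; last by rewrite divfK.
by rewrite normr0 mulr0 expr0n.
Qed.

Lemma norm_conjn z : `|conjn z| = `|z|.
Proof.
have [->|z0] := eqVneq z 0; first by rewrite /conjn invr0 mulr0.
by rewrite /conjn normrM normfV normrX normr_id expr2 mulfK// normr_eq0.
Qed.

Lemma conjn_continuous : continuous conjn.
Proof.
move=> z; have [->|z0] := eqVneq z 0.
  have conjn0 : conjn 0 = 0 by rewrite /conjn invr0 mulr0.
  rewrite /continuous_at conjn0.
  apply/(@cvgr0Pnorm_lt F F _ _ (nbhs_filter (0 : F))) => e e0.
  apply/nbhs_normP; exists e => //= w.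
  by rewrite /ball_ /= sub0r normrN norm_conjn.
have cn : `|w| @[w --> z] --> (`|z| : F) by exact: (@norm_continuous F F).
have cV : w^-1 @[w --> z] --> z^-1 by exact: (cvgV z0 (@cvg_id F (nbhs z))).
apply: (cvgM (f := fun w => `|w| ^+ 2) (g := fun w => w^-1) _ cV).
exact: (cvgM cn cn).
Qed.

(** Twice the tent function of radius 1 around [c]: the sum of a real number and
    its absolute value is twice its positive part. *)
Definition bump (c t : F) : F := (1 - `|t - c|) + `|1 - `|t - c| |.

Lemma bump_continuous c : continuous (bump c).
Proof.
move=> t.
have ct : `|s - c| @[s --> t] --> (`|t - c| : F).
  exact: (cvg_norm (cvgB (@cvg_id F (nbhs t)) (cvg_cst c))).
have c1 : 1 - `|s - c| @[s --> t] --> 1 - `|t - c|.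
  exact: (@cvgB F F _ _ _ _ _ _ _ (cvg_cst (1 : F)) ct).
exact: (cvgD c1 (cvg_norm c1)).
Qed.

Lemma bump_in c t : `|t - c| <= 1 -> bump c t = 2 * (1 - `|t - c|).
Proof.
by move=> h; rewrite /bump [X in _ + X]ger0_norm ?subr_ge0// mulr_natl mulr2n.
Qed.

Lemma bump_out c t : ~~ (`|t - c| < 1) -> bump c t = 0.
Proof.
rewrite -real_leNgt ?rpred1 ?normr_real// => h.
by rewrite /bump [X in _ + X]ler0_norm ?subr_le0// subrr.
Qed.

Lemma bump_bounded c t : `|bump c t| <= 2.
Proof.
have [h|/bump_out ->] := boolP (`|t - c| < 1); last by rewrite normr0.
rewrite bump_in ?(ltW h)// [leLHS]ger0_norm ?mulr_ge0 ?subr_ge0 ?(ltW h)//.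
by rewrite ler_piMr// gerBl.
Qed.

Lemma bump_ge1 c t : `|t - c| <= 2^-1 -> 1 <= `|bump c t|.
Proof.
move=> h; have h1 : `|t - c| <= 1.
  by apply: (le_trans h); rewrite invf_le1// ler1n.
rewrite bump_in// [leRHS]ger0_norm ?mulr_ge0 ?subr_ge0//.
rewrite mulrBr mulr1 lerBrDr -lerBrDl -addrA subrr addr0.
by rewrite -ler_pdivlMl// mulr1.
Qed.

End Scalars.

(** * Bounded continuous functions and their ideals *)

Section BoundedFunctions.
Context {F : numFieldType} {X : topologicalType}.
Implicit Types (f g : X -> F) (A : set (X -> F)).

Lemma closure_uniformP A f : closure (A : set {uniform X -> F}) f <->
   forall e : F, 0 < e -> exists2 g, A g & forall x, `|f x - g x| < e.
Proof.
split=> [cl e e0|h B /uniform_nbhs[E [+ EB]]].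
  have [] := cl [set g : {uniform X -> F} | forall x, `|f x - g x| < e].
    apply/uniform_nbhs; exists [set xy | ball xy.1 e xy.2].
    split => [|g /= hg x].
      exact: (entourage_ball _ (PosNum e0)).
    by have := hg x I; rewrite -ball_normE.
  by move=> g [Ag] /= hg; exists g.
rewrite -entourage_ballE => -[e /= e0 eE].
have [g Ag fg] := h e e0; exists g; split=> //.
by apply: EB => x _; apply: eE; rewrite /= -ball_normE; exact: fg.
Qed.

Lemma CBP f : CB F X f <-> continuous f /\ exists B, forall x, `|f x| <= B.
Proof.
split=> -[cf [B]].
  move=> [rB /(_ (B+1))]; rewrite ltrDl ltr01 => /(_ isT) hB.
  by split=> //; exists (B+1) => x; apply: hB.
move=> hB; split=> //; exists `|B|; split; first exact: normr_real.
move=> M BM x _; apply: (le_trans (hB x)); apply: le_trans (ltW BM).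
by apply: real_ler_norm; rewrite -(ler_real (hB x)) ger0_real.
Qed.

Lemma CB_cst (c : F) : CB F X (fun=> c).
Proof. by apply/CBP; split; [move=> x; exact: cvg_cst|exists `|c|]. Qed.

Lemma CBD f g : CB F X f -> CB F X g -> CB F X (f + g).
Proof.
move=> /CBP[cf [B hB]] /CBP[cg [C hC]]; apply/CBP; split.
  by move=> x; apply: cvgD; [exact: cf|exact: cg].
by exists (B + C) => x; apply: (le_trans (ler_normD _ _)); apply: lerD.
Qed.

Lemma CBM f g : CB F X f -> CB F X g -> CB F X (f * g).
Proof.
move=> /CBP[cf [B hB]] /CBP[cg [C hC]]; apply/CBP; split.
  by move=> x; apply: cvgM; [exact: cf|exact: cg].
by exists (B * C) => x; rewrite normrM; apply: ler_pM.
Qed.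

Lemma CB_comp_conjn f : CB F X f -> CB F X (conjn \o f).
Proof.
move=> /CBP[cf [B hB]]; apply/CBP; split.
  by move=> x; apply: continuous_comp; [exact: cf|exact: conjn_continuous].
by exists B => x; rewrite /= norm_conjn.
Qed.

Lemma CB_comp_bump c f : continuous f -> CB F X (bump c \o f).
Proof.
move=> cf; apply/CBP; split; last by exists 2 => x; exact: bump_bounded.
by move=> x; apply: continuous_comp; [exact: cf|exact: bump_continuous].
Qed.

Lemma CB_inv1D f : CB F X f -> (forall x, 0 <= f x) ->
  CB F X (fun x => (1 + f x)^-1).
Proof.
move=> /CBP[cf _] f0; apply/CBP; split.
  move=> x; apply: cvgV; first by rewrite gt_eqF// ltr_wpDr.
  by apply: cvgD; [exact: cvg_cst|exact: cf].
exists 1 => x; rewrite ger0_norm ?invr_ge0 ?addr_ge0// invf_le1 ?ltr_wpDr//.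
by rewrite lerDl.
Qed.

Lemma ideal_cstM A (c : F) f : ideal A -> A f -> A (fun x => c * f x).
Proof. by move=> [_ _ _ AM] Af; exact: (AM _ _ (CB_cst c) Af). Qed.

Lemma ideal_sumP A (I : Type) (r : seq I) (P : pred I) (g : I -> X -> F) :
  ideal A -> (forall i, P i -> A (g i)) -> A (\sum_(i <- r | P i) g i).
Proof. by move=> [_ A0 AD _] Ag; apply: big_ind. Qed.

Lemma ideal_sum_subideal (I : Type) (J : set I) (A : I -> set (X -> F)) H :
  ideal H -> (forall i, J i -> ideal (A i) /\ A i `<=` H) ->
  subideal H (ideal_sum J A).
Proof.
move=> iH hA; have sub : ideal_sum J A `<=` H.
  move=> _ [n [g [gA ->]]]; apply: ideal_sumP => // l _.
  by have [i Ji Aig] := gA l; apply: (hA i Ji).2.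
split=> //; split.
- by case: iH => HCB _ _ _; exact: subset_trans HCB.
- by exists 0%N, (fun=> 0); split; [case|rewrite big_ord0].
- move=> _ _ [n [g [gA ->]]] [m [k [kA ->]]].
  exists (n + m)%N.
  exists (fun l : 'I_(n + m) =>
    match fintype.split l with inl a => g a | inr b => k b end).
  split; first by move=> l; case: (fintype.split l) => a.
  rewrite big_split_ord; congr (_ + _); apply: eq_bigr => l _.
    by have /= -> := unsplitK (inl l : 'I_n + 'I_m).
  by have /= -> := unsplitK (inr l : 'I_n + 'I_m).
- move=> a _ aCB [n [g [gA ->]]]; exists n, (fun l => a * g l).
  split; last by rewrite mulr_sumr.
  move=> l; have [i Ji Aig] := gA l; exists i => //.
  by have [[_ _ _ AM] _] := hA i Ji; exact: AM.
Qed.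

Lemma ideal_genM f a : CB F X a -> ideal_gen f (a * f).
Proof. by move=> aCB A [[_ _ _ AM] fA]; apply: AM => //; exact: fA. Qed.

End BoundedFunctions.

(** * Topological preliminaries *)

(** If [P setT] failed, the complements of the members of [P] would form a proper
    filter; a cluster point of it has no neighbourhood in [P]. *)
Lemma compact_induction {T : topologicalType} (P : set (set T)) :
  compact [set: T] -> P set0 -> (forall A B, A `<=` B -> P B -> P A) ->
  (forall A B, P A -> P B -> P (A `|` B)) ->
  (forall y : T, exists2 U : set T, nbhs y U & P U) -> P setT.
Proof.
move=> cpt P0 Psub PU Ploc; apply: contrapT => nPT.
pose G : set_system T := [set A | P (~` A)].
have PFG : ProperFilter G.
  apply: Build_ProperFilter; first by rewrite /G /= setC0.
  split; first by rewrite /G /= setCT.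
    by move=> A B GA GB; rewrite /G /= setCI; exact: PU.
  by move=> A B AB; apply: Psub; exact: subsetC.
have GT : G setT by exact: filterT.
have [y [_ yG]] := cpt G PFG GT.
have [U yU PUU] := Ploc y.
have GU : G (~` U) by rewrite /G /= setCK.
by have [z []] := yG (~` U) U GU yU.
Qed.

Section NearContinuous.
Context {F : numFieldType} {T : topologicalType}.
Variables (f : T -> F) (y : T).
Hypothesis cf : {for y, continuous f}.

Lemma near_norm_gt (u : F) : u < `|f y| -> \forall z \near y, u < `|f z|.
Proof. exact: (cvgr_norm_gt (V := F) _ cf). Qed.

Lemma near_norm_lt (u : F) : `|f y| < u -> \forall z \near y, `|f z| < u.
Proof. exact: (cvgr_norm_lt (V := F) _ cf). Qed.

Lemma near_neq0 : f y != 0 -> \forall z \near y, f z != 0.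
Proof. exact: (cvgr_neq0 (V := F) _ cf). Qed.

Lemma near_dist_lt (e : F) : 0 < e -> \forall z \near y, `|f y - f z| < e.
Proof. by move/(@cvgrPdist_lt F F _ _ (nbhs_filter y) f (f y)): cf; exact. Qed.

End NearContinuous.

(** * Extensions to the Stone-Cech compactification *)

Section StoneCech.
Context {F : numFieldType} {X bX : topologicalType} {iota : X -> bX}.
Hypothesis sc : is_stone_cech F iota.
Implicit Types (f g h : X -> F) (H M : set (X -> F)) (y : bX).
Local Notation ext := (extension iota).

(** Density in the form in which it is used: properties that hold near a point of
    the compactification are tested on [X]. *)
Lemma nbhs_range y (V : set bX) : nbhs y V -> exists x, V (iota x).
Proof.
case: sc => _ _ _ dn _; rewrite nbhsE => -[U [oU Uy] UV].
have [z [Uz [x _ xz]]] := dn U (ex_intro _ y Uy) oU.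
by exists x; apply: UV; rewrite xz.
Qed.

Lemma iota_continuous : continuous iota.
Proof.
by case: sc => _ _ op _ _; apply/continuousP => U oU; apply/op; exists U.
Qed.

Lemma extP f : CB F X f -> continuous (ext f) /\ ext f \o iota = f.
Proof.
case: sc => _ _ _ _ hext fCB; have [g cg gf] := hext f fCB.
exact: (@xgetI _ 0 [set g | continuous g /\ g \o iota = f] g).
Qed.

Lemma ext_continuous f : CB F X f -> continuous (ext f).
Proof. by move=> /extP[]. Qed.

Lemma extE f x : CB F X f -> ext f (iota x) = f x.
Proof. by move=> /extP[_ fE]; rewrite -[in RHS]fE. Qed.

Lemma ext_unique f (g : bX -> F) : CB F X f -> continuous g ->
  (forall x, g (iota x) = f x) -> ext f = g.
Proof.
move=> fCB cg gf; apply/funext => y; apply/eqP; rewrite -subr_eq0.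
apply: contrapT => /negP n0.
have cfg : ext f z - g z @[z --> y] --> ext f y - g y.
  exact: (@cvgB F F _ _ _ _ _ _ _ (ext_continuous fCB (x := y)) (cg y)).
have [x] := nbhs_range (near_neq0 cfg n0).
by rewrite extE// gf subrr eqxx.
Qed.

Lemma extD f g y : CB F X f -> CB F X g -> ext (f + g) y = ext f y + ext g y.
Proof.
move=> fCB gCB; rewrite (@ext_unique _ (ext f + ext g))//; first exact: CBD.
  move=> z; apply: (@cvgD F F); exact: ext_continuous.
by move=> x; rewrite !fctE !extE.
Qed.

Lemma extM f g y : CB F X f -> CB F X g -> ext (f * g) y = ext f y * ext g y.
Proof.
move=> fCB gCB; rewrite (@ext_unique _ (ext f * ext g))//; first exact: CBM.
  move=> z; apply: cvgM; exact: ext_continuous.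
by move=> x; rewrite !fctE !extE.
Qed.

Lemma ext_cst (c : F) y : ext (fun=> c) y = c.
Proof.
by rewrite (@ext_unique _ (fun=> c))//; [exact: CB_cst|move=> z; exact: cvg_cst].
Qed.

Lemma ext0 y : ext (0 : X -> F) y = 0.
Proof. exact: (ext_cst 0). Qed.

Definition vanishing_on H (Z : set bX) : set (X -> F) :=
  [set h | H h /\ forall y, Z y -> ext h y = 0].

Lemma vanishing_ideal H Z : ideal H -> ideal (vanishing_on H Z).
Proof.
move=> [HCB H0 HD HM]; split.
- by move=> h [/HCB].
- by split=> // y _; exact: ext0.
- move=> f g [Hf fZ] [Hg gZ]; split; first exact: HD.
  by move=> y Zy; rewrite extD ?fZ ?gZ ?addr0//; exact: HCB.
- move=> a f aCB [Hf fZ]; split; first exact: HM.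
  by move=> y Zy; rewrite extM ?fZ ?mulr0//; exact: HCB.
Qed.

(** A uniform limit u on X of functions vanishing on Z extends to a function
    vanishing on Z: otherwise some m of them has |ext u - ext m| larger than
    |ext u y| / 2 at a point y of Z, hence also at points of X close to y. *)
Lemma vanishing_closed H Z :
  closed_ideal H -> closed_subideal H (vanishing_on H Z).
Proof.
move=> [iH clH]; split; last by move=> h [].
split; first exact: vanishing_ideal.
move=> u [clu uCB].
split; first by apply: clH; split=> //; apply: closureS clu => h [].
move=> y Zy; apply: contrapT => /eqP u0.
have e0 : 0 < `|ext u y| / 2 by rewrite divr_gt0// normr_gt0.
have [m [Hm mZ] um] := (closure_uniformP _ _).1 clu _ e0.
have mCB : CB F X m by case: iH => + _ _ _; apply.
have cum : ext u z - ext m z @[z --> y] --> ext u y - ext m y.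
  exact: (@cvgB F F _ _ _ _ _ _ _ (ext_continuous uCB (x := y))
    (ext_continuous mCB (x := y))).
have lt2 : `|ext u y| / 2 < `|ext u y - ext m y|.
  by rewrite mZ// subr0 ltr_pdivrMr// ltr_pMr ?normr_gt0// ltr1n.
have [x] := nbhs_range (near_norm_gt cum lt2).
by rewrite !extE// => /(lt_trans (um x)); rewrite ltxx.
Qed.

Lemma spectrum_open H : ideal H -> open (spectrum iota H).
Proof.
move=> [HCB _ _ _]; apply: bigcup_open => h Hh.
rewrite openE => y y0; rewrite /interior.
exact: (near_neq0 (@ext_continuous _ (HCB _ Hh) y) y0).
Qed.

Lemma spectrum_iota H x : ideal H -> non_vanishing H -> spectrum iota H (iota x).
Proof.
move=> [HCB _ _ _] H0; have [h Hh hx] := H0 x; exists h => //.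
by rewrite /coz /= extE//; exact: HCB.
Qed.

(** Evaluation at y is a nonzero linear form on H with kernel
    [vanishing_on H [set y]], so that this ideal has codimension one. *)
Lemma point_maximal H y : closed_ideal H -> spectrum iota H y ->
  maximal_closed_subideal H (vanishing_on H [set y]).
Proof.
move=> clH [h Hh hy]; have iH := clH.1; have [HCB _ _ _] := iH.
split; first exact: vanishing_closed.
  move=> E; move: Hh; rewrite -E => -[_ /(_ y erefl) hy0].
  by move: hy; rewrite /coz /= hy0 eqxx.
move=> N [[iN _] NH] NneqH MN; apply/seteqP; split=> // g Ng.
split; first exact: NH.
move=> _ ->; apply: contrapT => /eqP gy; apply: NneqH.
apply/seteqP; split=> // u Hu.
pose c := ext u y / ext g y.
(* u - c g vanishes at y, hence lies in N. *)
have -> : u = (u + (fun x => - c * g x)) + (fun x => c * g x).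
  by apply/funext => x; rewrite !fctE mulNr subrK.
have [_ _ ND _] := iN; apply: ND; last exact: ideal_cstM.
have Hg := NH _ Ng; have [_ _ HD _] := iH.
apply: MN; split; first by apply: HD => //; exact: ideal_cstM.
move=> _ ->; rewrite extD; [|exact: HCB|by apply: HCB; exact: ideal_cstM].
have -> : (fun x => - c * g x) = (fun=> - c) * g by [].
by rewrite extM ?ext_cst ?mulNr ?divfK ?subrr//; [exact: CB_cst|exact: HCB].
Qed.

(** After scaling, m takes the value 2 at y; then its squared modulus, which
    belongs to M as a multiple of m, is at least 1 near y. *)
Lemma local_lower_bound M y : ideal M -> (exists2 m, M m & ext m y != 0) ->
  exists m, [/\ M m, (forall x, 0 <= m x) &
    \forall z \near y, forall x, iota x = z -> 1 <= m x].
Proof.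
move=> iM [m Mm my]; have [MCB _ _ MM] := iM.
pose c := 2 / ext m y.
pose m1 : X -> F := fun x => c * m x.
have Mm1 : M m1 by exact: ideal_cstM.
have m1CB := MCB _ Mm1.
exists ((conjn \o m1) * m1); split.
- by apply: MM => //; exact: CB_comp_conjn.
- by move=> x; rewrite !fctE /= conjnM exprn_ge0.
have m1y : ext m1 y = 2.
  have -> : m1 = (fun=> c) * m by [].
  by rewrite extM ?ext_cst ?divfK//; [exact: CB_cst|exact: MCB].
have lt12 : 1 < `|ext m1 y| by rewrite m1y ger0_norm// ltr1n.
have near_y := near_norm_gt (@ext_continuous _ m1CB y) lt12.
apply: filterS near_y => z h x xz; move: h; rewrite -xz extE// => h.
by rewrite !fctE /= conjnM exprn_ege1// ltW.
Qed.

(** Fix h in H and e > 0.  By compactness, finitely many squared moduli of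
    elements of M add up to some m in M with m >= 1 wherever |h| >= e.  Then
    h N m / (1 + N m) lies in M, and differs from h by h / (1 + N m), which is
    small once N is large, as h is bounded; closedness of M concludes. *)
Lemma closed_subideal_full H M : closed_ideal H -> closed_subideal H M ->
  (forall y, spectrum iota H y -> exists2 m, M m & ext m y != 0) -> M = H.
Proof.
move=> [iH _] [[iM clM] MH] noz; apply/seteqP; split=> // h Hh.
have [HCB _ _ HM] := iH; have [MCB M0 MD MM] := iM.
have hCB := HCB _ Hh; have [_ [B hB]] := (CBP _).1 hCB.
apply: clM; split=> //; apply/closure_uniformP => e e0.
have [m [Mm mge0 hm]] : exists m, [/\ M m, (forall x, 0 <= m x) &
    forall x, [set: bX] (iota x) -> `|h x| < e \/ 1 <= m x].
  pose P U := exists m, [/\ M m, (forall x, 0 <= m x) &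
    forall x, U (iota x) -> `|h x| < e \/ 1 <= m x].
  have [[cpt _] _ _ _ _] := sc.
  apply: (compact_induction (P := P) cpt).
  - by exists 0.
  - by move=> U V UV [m [Mm m0 hm]]; exists m; split=> // x /UV; exact: hm.
  - move=> U V [m [Mm m0 hm]] [n [Mn n0 hn]]; exists (m + n).
    split; [exact: MD|by move=> x; rewrite addr_ge0|move=> x [/hm|/hn] []];
      by [left|right; rewrite (le_trans b)// ?lerDl ?lerDr].
  move=> y; have [hy|hy] := eqVneq (ext h y) 0.
    have lte : `|ext h y| < e by rewrite hy normr0.
    exists [set z | `|ext h z| < e].
      exact: near_norm_lt (@ext_continuous _ hCB y) _ lte.
    by exists 0; split=> // x /=; rewrite extE//; left.
  have [m [Mm m0 my]] := local_lower_bound iM (noz y (ex_intro2 _ _ h Hh hy)).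
  by eexists; [exact: my|exists m; split=> // x /(_ x erefl); right].
(* With this N, |h| / (1 + N) <= |B| / (1 + |B| / e) < e. *)
pose N := `|B| / e.
have N0 : 0 <= N by rewrite divr_ge0// ltW.
pose q : X -> F := fun x => N * m x.
have Mq : M q by exact: ideal_cstM.
have q0 x : 0 <= q x by rewrite mulr_ge0.
have qCB := CB_inv1D (MCB _ Mq) q0.
exists ((h * (fun x => (1 + q x)^-1)) * q).
  by apply: MM => //; exact: CBM.
move=> x; have q1 : 0 < 1 + q x by rewrite ltr_wpDr.
rewrite !fctE.
have -> : h x - h x * (1 + q x)^-1 * q x = h x / (1 + q x).
  apply: (mulIf (lt0r_neq0 q1)); rewrite mulrBl divfK ?lt0r_neq0//.
  by rewrite mulrAC divfK ?lt0r_neq0// mulrDr mulr1 addrK.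
rewrite normrM normfV (gtr0_norm q1) ltr_pdivrMr//.
case: (hm x I) => [he|m1].
  by apply: (lt_le_trans he); rewrite ler_pMr// lerDl.
apply: (@le_lt_trans _ _ (e * N)).
  rewrite mulrC divfK ?lt0r_neq0//; apply: (le_trans (hB x)).
  by apply: real_ler_norm; rewrite -(ler_real (hB x)) normr_real.
rewrite ltr_pM2l//; apply: (@le_lt_trans _ _ (q x)); first by rewrite ler_peMr.
by rewrite ltrDr.
Qed.

End StoneCech.
(** * Pseudocompactness of the spectrum *)

Section Spectrum.
Context {F : numFieldType} {X bX : topologicalType} {iota : X -> bX}.
Hypothesis sc : is_stone_cech F iota.
Hypothesis arch : forall x : F, exists n, `|x| < n%:R.
Variable H : set (X -> F).
Hypothesis clH : closed_ideal H.
Hypothesis H0 : non_vanishing H.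
Local Notation ext := (extension iota).

Definition discrete_family (I : Type) (A : I -> set (X -> F)) :=
  forall M, maximal_closed_subideal H M ->
    exists2 f, (H `\` M) f &
      is_subset1 [set i | ideal_gen f `&` A i <> [set 0]].

Let HCB f : H f -> CB F X f.
Proof. by move: f; case: clH => -[+ _ _ _] _; apply. Qed.

(** The neighbourhood is the set where ext f does not vanish, for the f outside
    the maximal ideal of y: if ext g and ext f are both nonzero at some point
    with g in A i, then g f is a nonzero element of A i generated by f. *)
Lemma discrete_family_locally (I : Type) (A : I -> set (X -> F)) y :
  (forall i, ideal (A i)) -> discrete_family A -> spectrum iota H y ->
  exists U, [/\ open U, U y &
    forall i j g h z w, U z -> U w -> A i g -> A j h ->
      ext g z != 0 -> ext h w != 0 -> i = j].
Proof.
move=> iA dA Sy.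
have ACB i : A i `<=` CB F X by case: (iA i).
have [f [Hf nMf] uf] := dA _ (point_maximal sc clH Sy).
have fCB := HCB Hf.
have fy : ext f y != 0.
  by apply: contra_notN nMf => /eqP fy; split=> // _ ->.
exists (coz (ext f)); split => //.
  rewrite openE => z fz; rewrite /interior.
  exact: near_neq0 (@ext_continuous _ _ _ _ sc _ fCB z) fz.
have meets i g z : coz (ext f) z -> A i g -> ext g z != 0 ->
    ideal_gen f `&` A i <> [set 0].
  move=> fz Ag gz E; have gCB := ACB _ _ Ag.
  have : (ideal_gen f `&` A i) (g * f).
    split; first exact: ideal_genM.
    by rewrite mulrC; case: (iA i) => _ _ _; apply=> //; exact: HCB.
  rewrite E /= => /(congr1 (fun u => ext u z)).
  rewrite (extM sc)// (ext0 sc) => /eqP; rewrite mulf_eq0 (negbTE gz) /=.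
  by apply/negP.
move=> i j g h z w fz fw Ag Ah gz hw.
by apply: uf; [exact: meets fz Ag gz|exact: meets fw Ah hw].
Qed.

Lemma infinite_sequence (I : Type) (A : I -> set (X -> F)) (B : set (X -> F)) :
  infinite_set [set: I] -> injective A ->
  exists2 e : nat -> I, injective e & forall n, A (e n) <> B.
Proof.
move=> /infiniteP/card_leP[e0] injA.
pose e (n : nat) : I := val (e0 (SigSub (in_setT n))).
have inje : injective e.
  move=> m n /val_inj /(inj (f := e0)); rewrite !inE => E.
  by case: (E Logic.I Logic.I).
(* By injectivity at most one index is sent to B, and the sequence can start
   after it. *)
have [[k ek]|nB] := pselect (exists k, A (e k) = B); last first.
  by exists e => // n enB; apply: nB; exists n.
exists (fun n => e (n + k.+1)%N); first by move=> m n /inje /addIn.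
move=> n enB; have /inje /eqP : e (n + k.+1)%N = e k by apply: injA; rewrite ek.
by rewrite addnS -addSn -[X in _ == X]add0n eqn_add2r.
Qed.

(** The functions g n of the proof are taken in different members of the family
    and scaled so that g n takes the value n; their sum is locally equal to one
    of them, hence continuous on the spectrum. *)
Lemma unbounded_of_discrete_family (I : Type) (A : I -> set (X -> F)) :
  infinite_set [set: I] -> injective A -> (forall i, ideal (A i)) ->
  discrete_family A -> ~ pseudocompact F (spectrum iota H).
Proof.
move=> infI injA iA dA psc.
have ACB i : A i `<=` CB F X by case: (iA i).
have [e inje eA] := infinite_sequence [set 0] infI injA.
have /choice[g gP] n : exists g, A (e n) g /\ exists x, g x = n%:R.
  have [g [Ag [x gx]]] : exists g, A (e n) g /\ exists x, g x != 0.
    apply: contrapT => nog; apply: (eA n); apply/seteqP; split=> [u Au|_ ->].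
      apply/funext => x; apply: contrapT => /eqP ux; apply: nog.
      by exists u; split=> //; exists x.
    by case: (iA (e n)).
  exists (fun z => n%:R / g x * g z); split; first exact: ideal_cstM.
  by exists x; rewrite divfK.
pose P y n := ext (g n) y != 0.
(* The sum of the ext (g n), at most one of which is nonzero at y; the value is 0
   when none is, whatever the default index. *)
pose f y := ext (g (xget 0%N (P y))) y.
have fE U : (forall i j u v z w, U z -> U w -> A i u -> A j v ->
      ext u z != 0 -> ext v w != 0 -> i = j) ->
    forall y n, U y -> ext (g n) y != 0 -> forall z, U z -> f z = ext (g n) z.
  move=> Uu y n Uy ny z Uz; rewrite /f.
  case: xgetP => [m _ mz|nP]; first last.
    have g0 k : ext (g k) z = 0.
      by apply: contrapT => /eqP kz; exact: (nP k kz).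
    by rewrite !g0.
  suff -> : m = n by [].
  by apply: inje; apply: (Uu _ _ (g m) (g n) z y) => //; exact: (gP _).1.
have loc y : spectrum iota H y -> exists U, [/\ open U, U y &
    forall i j u v z w, U z -> U w -> A i u -> A j v ->
      ext u z != 0 -> ext v w != 0 -> i = j].
  exact: discrete_family_locally.
have cf : {within spectrum iota H, continuous f}.
  apply: continuous_in_subspaceT => y /set_mem Sy.
  have [U [oU Uy Uu]] := loc y Sy.
  have nU : \forall z \near y, U z by exact: open_nbhs_nbhs.
  have [[z [n [Uz nz]]]|no] := pselect (exists z n, U z /\ ext (g n) z != 0).
    have fg := fE U Uu z n Uz nz.
    have gc : {for y, continuous (ext (g n))}.
      by apply: (ext_continuous sc); apply: ACB; exact: (gP n).1.
    rewrite /continuous_at (fg y Uy).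
    apply: cvg_trans gc; apply: near_eq_cvg.
    by apply: filterS nU => w Uw; rewrite fg.
  have f0 w : U w -> f w = 0.
    move=> Uw; apply: contrapT => /eqP fw; apply: no.
    by do 2 eexists; split; [exact: Uw|exact: fw].
  apply: (@near_cst_continuous _ _ 0).
  by apply: filterS nU => w Uw; rewrite f0.
have [B [Breal hB]] := psc f cf.
have [n Bn] := arch (B + 1).
have [x gx] := (gP n.+1).2.
have gx0 : ext (g n.+1) (iota x) != 0.
  rewrite (extE sc) ?gx ?pnatr_eq0//; apply: ACB; exact: (gP n.+1).1.
have Sx : spectrum iota H (iota x) by apply: (spectrum_iota sc) => //; case: clH.
have [U [_ Ux Uu]] := loc _ Sx.
have fx : f (iota x) = n.+1%:R.
  rewrite (fE U Uu _ _ Ux gx0 _ Ux) (extE sc) ?gx//.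
  by apply: ACB; exact: (gP n.+1).1.
have := hB (B + 1); rewrite ltrDl ltr01 => /(_ isT _ Sx).
have Bn' := le_lt_trans (real_ler_norm (realD Breal (@real1 F))) Bn.
rewrite /= fx normr_nat => /le_lt_trans/(_ Bn').
by rewrite ltr_nat ltnNge leqnSn.
Qed.

Section Unbounded.
Variable f : bX -> F.
Hypothesis cf : forall y, spectrum iota H y -> {for y, continuous f}.
Hypothesis unb : forall B : F, B \is Num.real ->
  exists2 y, spectrum iota H y & B < `|f y|.

Let iH : ideal H := clH.1.
Let Siota x : spectrum iota H (iota x) := spectrum_iota sc x iH H0.
Let v x : F := `|f (iota x)|.

Let v_continuous : continuous v.
Proof.
move=> x; apply: (continuous_comp (f := iota) (g := fun y => `|f y|)).
  exact: iota_continuous sc x.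
apply: (continuous_comp (f := f)); first exact: cf.
exact: (@norm_continuous F F).
Qed.

Lemma unbounded_on_X (B : F) : B \is Num.real -> exists x, B < v x.
Proof.
move=> /unb[y Sy By].
exact: (nbhs_range sc (near_norm_gt (cf Sy) By)).
Qed.

Lemma separated_sequence : exists t : nat -> X,
  forall m n, (m < n)%N -> v (t m) + 4 < v (t n).
Proof.
have /choice[s sP] (x : X) : exists x', v x + 4 < v x'.
  by apply: unbounded_on_X; rewrite realD ?normr_real ?realn.
have [x0 _] := unbounded_on_X (@real0 F).
exists (fun n => iter n s x0) => m n; elim: n => // n IH.
rewrite ltnS leq_eqVlt => /orP[/eqP ->|/IH h]; first exact: sP.
by apply: (lt_trans h); apply: (lt_trans _ (sP _)); rewrite ltrDl.
Qed.

Definition shell (t : nat -> X) n : set X := [set x | `|v x - v (t n)| < 1].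

(** The gap 4 splits as 1 + 2 + 1: shells have radius 1, and 2 is the diameter of
    the support of a bump function of v. *)
Lemma shell_inj t m n x x' : (forall m n, (m < n)%N -> v (t m) + 4 < v (t n)) ->
  shell t m x -> shell t n x' -> `|v x - v x'| < 2 -> m = n.
Proof.
move=> tP; wlog mn : m n x x' / (m <= n)%N.
  move=> W hx hx' d; have [mn|/ltnW nm] := leqP m n; first exact: W hx hx' d.
  by apply/esym; apply: W nm hx' hx _; rewrite distrC.
move=> hx hx' d; move: mn; rewrite leq_eqVlt => /orP[/eqP//|/tP].
rewrite -ltrBrDl => lt4; exfalso.
have : 4 < `|v (t n) - v (t m)|.
  apply: (lt_le_trans lt4); apply: real_ler_norm.
  by rewrite realB ?normr_real.
have -> : v (t n) - v (t m) =
    (v (t n) - v x') + ((v x' - v x) + (v x - v (t m))).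
  by rewrite (addrA (v x' - v x)) subrK addrA subrK.
move=> /lt_le_trans/(_ (ler_normD _ _)).
have le3 : `|v x' - v x + (v x - v (t m))| < 2 + 1.
  by apply: (le_lt_trans (ler_normD _ _)); apply: ltrD => //; rewrite distrC.
have le4 : `|v (t n) - v x'| + `|v x' - v x + (v x - v (t m))| < 1 + (2 + 1).
  by apply: ltrD => //; rewrite distrC.
move=> /lt_trans/(_ le4).
have -> : 1 + (2 + 1) = 4 :> F by rewrite (natrD _ 1 3) (natrD _ 2 1).
by rewrite ltxx.
Qed.

Lemma vanishing_on_X (Z : set X) h : H h ->
  vanishing_on (iota := iota) H (iota @` Z) h <-> forall x, Z x -> h x = 0.
Proof.
move=> Hh; split=> [[_ hZ] x Zx|hZ].
  by rewrite -(extE sc x (HCB Hh)); apply: hZ; exists x.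
by split=> // _ [x Zx <-]; rewrite (extE sc) ?hZ//; exact: HCB.
Qed.

Lemma discrete_family_of_unbounded :
  exists D : set (X -> F), subideal H D /\
    exists (I : Type) (A : I -> set (X -> F)),
      [/\ infinite_set [set: I] /\ injective A,
          (forall i, closed_subideal H (A i)),
          is_direct_sum A D & discrete_family A].
Proof.
have [t tP] := separated_sequence.
(* The elements of H supported, as functions on X, in the n-th shell. *)
pose A n := vanishing_on (iota := iota) H (iota @` (~` shell t n)).
have AH n : A n `<=` H by move=> h [].
have clA n : closed_subideal H (A n) by exact: vanishing_closed.
have iA n : ideal (A n) by case: (clA n) => -[].
have Ashell n h x : A n h -> h x != 0 -> shell t n x.
  move=> Ah hx; apply: contrapT => nx; move/eqP: hx; apply.
  by move/(vanishing_on_X _ (AH _ _ Ah)): Ah; apply.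
have HM a h : CB F X a -> H h -> H (a * h) by case: iH => _ _ _; apply.
have tshell n : shell t n (t n) by rewrite /shell /= subrr normr0.
exists (ideal_sum setT A); split.
  by apply: ideal_sum_subideal => // n _.
exists nat, A; split=> //.
- split; first exact: infinite_nat.
  move=> m n Amn; have [h Hh hx] := H0 (t m).
  have : A m ((bump (v (t m)) \o v) * h).
    have Hbh : H ((bump (v (t m)) \o v) * h).
      by apply: HM => //; exact: CB_comp_bump.
    apply/vanishing_on_X => // x /negP nx.
    by rewrite !fctE /= bump_out// mul0r.
  rewrite Amn => /(Ashell _ _ (t m)) hn.
  apply: (shell_inj tP (tshell m) (hn _)); last by rewrite subrr normr0.
  by rewrite !fctE /= mulf_neq0// bump_in subrr normr0// subr0 mulr1.
- split=> // n; apply/seteqP; split=> [h [Ah [k [g [gA hE]]]]|_ ->].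
    apply/funext => x; apply: contrapT => /eqP hx.
    have nx := Ashell _ _ _ Ah hx; move: hx.
    rewrite hE fct_sumE big1 ?eqxx// => l _; apply: contrapT => /eqP lx.
    have [i ni Ai] := gA l; apply: ni.
    apply: (shell_inj tP nx (Ashell _ _ _ Ai lx)).
    by rewrite subrr normr0.
  split; first by case: (iA n).
  by exists 0%N, (fun=> 0); split; [case|rewrite big_ord0].
move=> M [[clM MH] MneqH _].
have [y [Sy My]] : exists y, spectrum iota H y /\ forall m, M m -> ext m y = 0.
  apply: contrapT => ny; apply: MneqH.
  apply: (closed_subideal_full sc) => // y Sy.
  apply: contrapT => nm; apply: ny; exists y; split=> // m Mm.
  by apply: contrapT => /eqP my; apply: nm; exists m.
have [h Hh hy] := Sy.
pose c := `|f y|; pose a := bump c \o v.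
have aCB : CB F X a by exact: CB_comp_bump.
have Hah : H (a * h) by exact: HM.
exists (a * h).
  split=> // /My ah0.
  (* At points of X close to y, |a h| >= |h| > |ext h y| / 2, whereas ext (a h)
     would be small there if it vanished at y. *)
  have hy0 : 0 < `|ext h y| by rewrite normr_gt0.
  have n1 := near_dist_lt (cf Sy) (e := 2^-1) (ltac:(by rewrite invr_gt0)).
  have n2 : \forall z \near y, `|ext h y| / 2 < `|ext h z|.
    apply: near_norm_gt; first by apply: (ext_continuous sc); exact: HCB.
    by rewrite ltr_pdivrMr// ltr_pMr// ltr1n.
  have n3 : \forall z \near y, `|ext (a * h) z| < `|ext h y| / 2.
    apply: near_norm_lt; first by apply: (ext_continuous sc); exact: HCB.
    by rewrite ah0 normr0 divr_gt0.
  have [x [x1 [x2 x3]]] := nbhs_range sc (filterI n1 (filterI n2 n3)).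
  move: x2 x3; rewrite !(extE sc); [|exact: HCB..].
  rewrite !fctE normrM => x2 x3.
  have a1 : 1 <= `|a x|.
    apply: bump_ge1; apply: (le_trans (ler_dist_dist _ _)).
    by rewrite distrC ltW.
  have := lt_trans x3 x2.
  rewrite -[X in _ < X]mul1r ltr_pM2r ?normr_gt0; last first.
    by rewrite -normr_gt0; apply: lt_trans x2; rewrite divr_gt0.
  by move=> /(le_lt_trans a1); rewrite ltxx.
have gen u x : ideal_gen (a * h) u -> u x != 0 -> `|v x - c| < 1.
  move=> gu; apply: contraNT => nx.
  have [Hu uZ] : vanishing_on (iota := iota) H
      (iota @` [set x | ~~ (`|v x - c| < 1)]) u.
    apply: gu; split; first by apply: vanishing_ideal.
    move=> _ ->; apply/vanishing_on_X => // z /= nz.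
    by rewrite !fctE /a /= bump_out// mul0r.
  by rewrite -(extE sc x (HCB Hu)) uZ//; exists x.
have meets n : ideal_gen (a * h) `&` A n <> [set 0] ->
    exists2 x, shell t n x & `|v x - c| < 1.
  move=> ne; apply: contrapT => nx; apply: ne.
  apply/seteqP; split=> [u [gu Au]|_ ->].
    apply/funext => x; apply: contrapT => /eqP ux; apply: nx.
    by exists x; [exact: Ashell Au ux|exact: gen gu ux].
  split; last by case: (iA n).
  by move=> J [[_ + _ _] _].
move=> m n /meets[x xm xc] /meets[x' xn xc'].
apply: (shell_inj tP xm xn).
have -> : v x - v x' = (v x - c) + (c - v x') by rewrite addrA subrK.
apply: (le_lt_trans (ler_normD _ _)).
by rewrite [X in _ < X](_ : _ = 1 + 1)//; apply: ltrD => //; rewrite distrC.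
Qed.

End Unbounded.
End Spectrum.

Lemma scalars_archimedean (R : realType) (k : scalar_kind) (x : scalars R k) :
  exists n, `|x| < n%:R.
Proof.
case: k x => /= x; first by exists (Num.truncn `|x|).+1; exact: truncnS_gt.
rewrite normc_def.
set r := Num.sqrt _; exists (Num.truncn r).+1.
have <- n : real_complex R n%:R = n%:R by rewrite rmorph_nat.
by rewrite ltcR; exact: truncnS_gt.
Qed.

Theorem theorem3p12 (R : realType) (k : scalar_kind)
    (X : topologicalType)
    (hX : completely_regular_space X) (hX2 : hausdorff_space X)
    (bX : topologicalType) (iota : X -> bX)
    (hbX : is_stone_cech (scalars R k) iota)
    (H : set (X -> scalars R k))
    (hH : closed_ideal H) (hH0 : non_vanishing H) :
  pseudocompact (scalars R k) (spectrum iota H)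
  <->
  ~ (exists D : set (X -> scalars R k),
      subideal H D /\
      exists (I : Type) (A : I -> set (X -> scalars R k)),
        [/\ infinite_set [set: I] /\ injective A,
            (forall i, closed_subideal H (A i)),
            is_direct_sum A D &
            forall M, maximal_closed_subideal H M ->
              exists2 f, (H `\` M) f &
                is_subset1 [set i | ideal_gen f `&` A i <> [set 0]]]).
Proof.
have SH := spectrum_open hbX hH.1.
split=> [psc [D [_ [I [A [[infI injA] clA _ dA]]]]]|noD f cf].
  apply: (unbounded_of_discrete_family hbX (@scalars_archimedean R k) hH hH0
    infI injA _ dA) psc.
  by move=> i; case: (clA i) => -[].
apply: contrapT => nb; apply: noD.
apply: (discrete_family_of_unbounded hbX hH hH0 (f := f)).
  move=> y Sy; move: cf; rewrite continuous_open_subspace//; apply.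
  by rewrite inE.
move=> B rB; apply: contrapT => nB; apply: nb; exists B; split=> // M BM y Sy.
apply: contrapT => /negP; rewrite -real_ltNge ?normr_real// ?gtr_real//.
  by move=> My; apply: nB; exists y => //; exact: lt_trans My.
by rewrite -(ler_real (ltW BM)).
Qed.
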